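(* Each of the two geometric 4-colorings $\gamma_1,\gamma_2$ of $L_{Moser}$ extends to a geometric 4-coloring of the Moser ring $R_2$. Explicitly, for $v = \frac{a + b\omega_1 + c\omega_3 + d\omega_1\omega_3}{3^k}\in R_2$ (with $a,b,c,d,k\in\mathbb{Z}$), the formula \[ \pi(v) = 1 + l_1 + 2 l_2, \qquad l_1,l_2\in\{0,1\}, \] gives a well-defined geometric 4-coloring $\pi:R_2\to\{1,2,3,4\}$ in each of the following two cases: (1) $l_1\equiv a+b+d \pmod 2$ and $l_2\equiv a+c+d\pmod 2$ (extending $\gamma_1$); (2) $l_1\equiv a+d\pmod 2$ and $l_2\equiv b+c+d\pmod 2$ (extending $\gamma_2$).
   Context: Let $\omega_1 = \frac12 + i\frac{\sqrt3}{2}$ and $\omega_3 = \frac56 + i\frac{\sqrt{11}}{6}$ in $\mathbb{C}\cong\mathbb{R}^2$. The Moser lattice is $L_{Moser} = \{a + b\omega_1 + c\omega_3 + d\omega_1\omega_3 : a,b,c,d\in\mathbb{Z}\}$, and the Moser ring is $R_2 = \left\{\frac{a + b\omega_1 + c\omega_3 + d\omega_1\omega_3}{3^k} : a,b,c,d,k\in\mathbb{Z}\right\}$. The colorings $\gamma_1,\gamma_2$ of $L_{Moser}$ are those with color map $a + b\omega_1 + c\omega_3 + d\omega_1\omega_3\mapsto 1+l_1+2l_2$, where $l_1,l_2\in\{0,1\}$ are the mod 2 residues of $a+b+d$ and $a+c+d$ for $\gamma_1$, and of $a+d$ and $b+c+d$ for $\gamma_2$. For points $x,y$ of the plane, $d(x,y)=|x-y|$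 is the Euclidean distance. For an additive subgroup $L$ of the plane, an (integral) geometric $k$-coloring of $L$ is a map $\pi: L\to\{1,\dots,k\}$ such that (i) $d(x,y)=1 \implies \pi(x)\neq\pi(y)$; and (ii) for all $x,y,z,w\in L$ with $d(x,y)=d(z,w)$, one has $\pi(x)=\pi(y) \iff \pi(z)=\pi(w)$. *)

(* Defs.v *)
From HB Require Import structures.
From mathcomp Require Import all_boot all_order all_algebra.
From mathcomp Require Import boolp reals.
From mathcomp Require Import complex.
From mathcomp Require Import ring.

Set Implicit Arguments.
Unset Strict Implicit.
Unset Printing Implicit Defensive.

Import Order.TTheory GRing.Theory Num.Theory.
Local Open Scope ring_scope.
Local Open Scope complex_scope.

Definition omega1 (R : realType) : R[i] := (1 / 2) +i* (Num.sqrt 3 / 2).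

Definition omega3 (R : realType) : R[i] := (5 / 6) +i* (Num.sqrt 11 / 6).

Definition lattice_point (R : realType) (a b c d : int) : R[i] :=
  a%:~R + b%:~R * omega1 R + c%:~R * omega3 R
  + d%:~R * (omega1 R * omega3 R).

(* [k] ranges over all of [int]: [3 ^ k] is integer exponentiation. *)
Definition ring_point (R : realType) (a b c d k : int) : R[i] :=
  lattice_point R a b c d / 3 ^ k.

Definition moser_lattice (R : realType) (z : R[i]) : bool :=
  `[< exists a b c d : int, z = lattice_point R a b c d >].

Definition moser_ring (R : realType) (z : R[i]) : bool :=
  `[< exists a b c d k : int, z = ring_point R a b c d k >].

Lemma lattice_pointB (R : realType) (a b c d a' b' c' d' : int) :
  lattice_point R a b c d - lattice_point R a' b' c' d' =
  lattice_point R (a - a') (b - b') (c - c') (d - d').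
Proof. by rewrite /lattice_point !intrB; ring. Qed.

Lemma lattice_pointZ (R : realType) (n a b c d : int) :
  n%:~R * lattice_point R a b c d =
  lattice_point R (n * a) (n * b) (n * c) (n * d).
Proof. by rewrite /lattice_point !mulrDr !intrM !mulrA. Qed.

Lemma moser_lattice_zmod_closed (R : realType) : zmod_closed (@moser_lattice R).
Proof.
split=> [|x y /asboolP[a [b [c [d ->]]]] /asboolP[a' [b' [c' [d' ->]]]]].
  by apply/asboolP; exists 0, 0, 0, 0; rewrite /lattice_point !mul0r !addr0.
apply/asboolP; exists (a - a'), (b - b'), (c - c'), (d - d').
exact: lattice_pointB.
Qed.

HB.instance Definition _ (R : realType) :=
  GRing.isZmodClosed.Build R[i] (@moser_lattice R)
    (moser_lattice_zmod_closed R).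

Lemma ring_point_scale (R : realType) (a b c d k : int) (n : nat) :
  (`|k| <= n)%N -> exists m : int,
    ring_point R a b c d k = ring_point R (m * a) (m * b) (m * c) (m * d) n.
Proof.
move=> kn; have n3 : (3 : R[i]) != 0 by rewrite pnatr_eq0.
have [j jE] : exists j : nat, n%:Z - k = j.
  exists `|n%:Z - k|%N; rewrite gez0_abs // subr_ge0.
  by apply: le_trans (ler_norm k) _; rewrite -abszE lez_nat.
exists (3 ^+ j); rewrite /ring_point -lattice_pointZ rmorphXn /=.
rewrite [X in X ^+ j](_ : _ = 3) // mulrAC [LHS]mulrC; congr (_ * _).
by rewrite -[3 ^+ j]/(3 ^ j%:Z) -jE !invr_expz -expfzDr // addrAC subrr add0r.
Qed.

Lemma moser_ring_zmod_closed (R : realType) : zmod_closed (@moser_ring R).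
Proof.
split=> [|x y /asboolP[a [b [c [d [k ->]]]]]
              /asboolP[a' [b' [c' [d' [k' ->]]]]]].
  apply/asboolP; exists 0, 0, 0, 0, 0.
  by rewrite /ring_point /lattice_point !mul0r !addr0 mul0r.
have [m ->] := ring_point_scale R a b c d (leq_addr `|k'| `|k|).
have [m' ->] := ring_point_scale R a' b' c' d' (leq_addl `|k| `|k'|).
by apply/asboolP; do 5 eexists; rewrite /ring_point -mulrBl lattice_pointB.
Qed.

HB.instance Definition _ (R : realType) :=
  GRing.isZmodClosed.Build R[i] (@moser_ring R) (moser_ring_zmod_closed R).

Definition carrier (R : realType) (L : {pred R[i]}) : Type :=
  {z : R[i] | z \in L}.

(* The norm of [R[i]] takes its values in [R[i]] itself, so that distances are
   compared there; it is the embedding of the real Euclidean norm. *)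
Definition dist (R : realType) (x y : R[i]) : R[i] := `|x - y|.

Definition geometric_coloring (R : realType) (L : zmodClosed R[i]) (k : nat)
    (f : carrier L -> nat) : Prop :=
  [/\ forall x, (1 <= f x <= k)%N,
      forall x y, dist (val x) (val y) = 1 -> f x <> f y
    & forall x y z w, dist (val x) (val y) = dist (val z) (val w) ->
        (f x = f y <-> f z = f w)].

(* [(m %% 2)%Z] is 0 or 1, also for negative [m]. *)
Definition residue2 (m : int) : nat := `|(m %% 2)%Z|%N.

Definition color_rule1 (a b c d : int) : nat :=
  (1 + residue2 (a + b + d) + 2 * residue2 (a + c + d))%N.

Definition color_rule2 (a b c d : int) : nat :=
  (1 + residue2 (a + d) + 2 * residue2 (b + c + d))%N.

(* The rule has to be obeyed for every representation of every point: the
   existence of [f] is the well-definedness of the color map. *)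
Definition lattice_color_map (R : realType)
    (rule : int -> int -> int -> int -> nat)
    (f : carrier (@moser_lattice R) -> nat) : Prop :=
  forall (v : carrier (@moser_lattice R)) (a b c d : int),
    val v = lattice_point R a b c d -> f v = rule a b c d.

Definition ring_color_map (R : realType)
    (rule : int -> int -> int -> int -> nat)
    (f : carrier (@moser_ring R) -> nat) : Prop :=
  forall (v : carrier (@moser_ring R)) (a b c d k : int),
    val v = ring_point R a b c d k -> f v = rule a b c d.

Definition extends (R : realType) (L M : zmodClosed R[i])
    (g : carrier L -> nat) (f : carrier M -> nat) : Prop :=
  {subset L <= M} /\
  forall (x : carrier L) (y : carrier M), val y = val x -> f y = g x.

(* Main.v *)
(* For v = a + b w1 + c w3 + d w1 w3 one has
     6 |v|^2 = F1 (1 + sqrt 33) + F2 (1 - sqrt 33)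
   with integral quadratic forms F1, F2 in a, b, c, d. Since sqrt 33 is
   irrational, |v| determines F1 and F2; dividing v by 3^k divides them by 9^k,
   which is odd, so the parities of F1 and F2 depend only on the length, even
   in the Moser ring. Modulo 2, F1 (resp. F2) is x^2 + x y + y^2, where x, y are
   the two linear forms of the first (resp. second) color rule; this is even
   exactly when x and y both are. So two points share a color exactly when the
   form of their difference is even, and well-definedness is the case of length
   0. At length 1 the form takes the odd value 3 on the vector 1. *)
Require Import Defs.
From mathcomp Require Import all_boot all_order all_algebra.
From mathcomp Require Import reals complex.
From mathcomp Require Import boolp ring lra zify.

Set Implicit Arguments.
Unset Strict Implicit.
Unset Printing Implicit Defensive.

Import Order.TTheory GRing.Theory Num.Theory.
Local Open Scope ring_scope.
Local Open Scope complex_scope.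

(** If [q] were nonzero, the exponent of 3 would be even in [p ^+ 2] and odd in [33 * q ^+ 2]. *)
Lemma sqr_eq_33sqr (p q : int) : p ^+ 2 = 33 * q ^+ 2 -> q = 0.
Proof.
move=> /(congr1 absz); rewrite abszM !abszX => E.
apply/eqP; rewrite -absz_eq0; apply: contraT; rewrite -lt0n => q0.
move/(congr1 (logn 3)): E; rewrite lognM ?expn_gt0 ?q0 // !lognX.
rewrite [logn 3 `|33%:Z|](_ : _ = 1%N) //; lia.
Qed.

(* F1 for [e = true], F2 for [e = false]. *)
Definition moser_form (e : bool) (a b c d : int) : int :=
  3 * (a ^+ 2 + b ^+ 2 + c ^+ 2 + d ^+ 2 + a * b + c * d)
  + 5 * (a * c + b * d) + 2 * (a * d + b * c) + (if e then b * c else a * d).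

Lemma moser_formZ e m a b c d :
  moser_form e (m * a) (m * b) (m * c) (m * d) = m ^+ 2 * moser_form e a b c d.
Proof. by case: e; rewrite /moser_form; ring. Qed.

(** * Lengths in the Moser ring in terms of the two forms *)

Section Norm.
Variable R : realType.
Local Notation C := R[i].
Local Notation w1 := (omega1 R).
Local Notation w3 := (omega3 R).

(** Twice the real part of [w1] is 1. With the analogue for [w3], this turns squared norms into
    polynomials in [w1] and [w3]. *)
Lemma omega1_conj : Num.conj w1 = 1 - w1.
Proof.
by apply/eqP; rewrite eq_complex /=; apply/andP; split; apply/eqP; lra.
Qed.

Lemma omega3_conj : Num.conj w3 = 5 / 3 - w3.
Proof.
have -> : 5 / 3 = (5 / 3 : R)%:C by rewrite rmorphM fmorphV !rmorph_nat.
by apply/eqP; rewrite eq_complex /=; apply/andP; split; apply/eqP; lra.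
Qed.

Lemma omega1_sqr : w1 * w1 = w1 - 1.
Proof.
have := sqr_sqrtr (ler0n R 3) => h.
apply/eqP; rewrite eq_complex /=; apply/andP; split; apply/eqP; nra.
Qed.

Lemma omega3_sqr : w3 * w3 = 5 / 3 * w3 - 1.
Proof.
have := sqr_sqrtr (ler0n R 11) => h.
have -> : 5 / 3 = (5 / 3 : R)%:C by rewrite rmorphM fmorphV !rmorph_nat.
apply/eqP; rewrite eq_complex /=; apply/andP; split; apply/eqP; nra.
Qed.

(* This is -12 (w1 - 1/2) (w3 - 5/6), that is, sqrt 33. *)
Definition root33 : C := 10 * w1 + 6 * w3 - 12 * (w1 * w3) - 5.

Lemma root33_sqr : root33 ^+ 2 = 33.
Proof.
(* The factors are the squares of [w1 - 1/2] and [w3 - 5/6], expanded so that the quadratic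
   relations reduce them to -3/4 and -11/36. *)
have -> : root33 ^+ 2 =
    144 * (w1 * w1 - w1 + 1 / 4) * (w3 * w3 - 5 / 3 * w3 + 25 / 36).
  by rewrite /root33; field.
by rewrite omega1_sqr omega3_sqr; field.
Qed.

Lemma lattice_point_norm a b c d :
  6 * `|lattice_point R a b c d| ^+ 2 =
  (moser_form true a b c d)%:~R * (1 + root33)
  + (moser_form false a b c d)%:~R * (1 - root33).
Proof.
rewrite normCK /lattice_point /moser_form /root33.
rewrite !(rmorphD, rmorphM, rmorph_int) /= omega1_conj omega3_conj.
have n1 : w1 * (1 - w1) = 1 by rewrite mulrBr mulr1 omega1_sqr; ring.
have n3 : w3 * (5 / 3 - w3) = 1 by rewrite mulrBr omega3_sqr; ring.
move: (a%:~R : C) (b%:~R : C) (c%:~R : C) (d%:~R : C) => {}a {}b {}c {}d.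
(* The square of |(a + b w1) + (c + d w1) w3| is expanded with the products of [w1] and [w3] with
   their conjugates kept intact, so that [n1] and [n3] can replace them by 1. *)
rewrite [X in 6 * X](_ : _ =
    (a ^+ 2 + a * b + b ^+ 2 * (w1 * (1 - w1)))
  + (c ^+ 2 + c * d + d ^+ 2 * (w1 * (1 - w1))) * (w3 * (5 / 3 - w3))
  + (a * c + b * c * w1 + a * d * (1 - w1) + b * d * (w1 * (1 - w1)))
    * (5 / 3 - w3)
  + (a * c + a * d * w1 + b * c * (1 - w1) + b * d * (w1 * (1 - w1))) * w3);
  last by field.
by rewrite n1 n3; field.
Qed.

Lemma root33_free (x y : int) :
  x%:~R * (1 + root33) + y%:~R * (1 - root33) = 0 -> x = 0 /\ y = 0.
Proof.
move=> h.
(* Isolating [root33] and squaring leaves an equation between integers. *)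
have e : ((x + y)%:~R : C) = (y - x)%:~R * root33.
  by apply/eqP; rewrite -subr_eq0 -h rmorphD rmorphB /=; apply/eqP; ring.
have /sqr_eq_33sqr : (x + y) ^+ 2 = 33 * (y - x) ^+ 2.
  apply: (@intr_inj C); rewrite rmorphXn /= e exprMn root33_sqr.
  by rewrite rmorphM rmorphXn /= mulrC.
move=> yx; have xy : x = y by lia.
move: e; rewrite xy subrr mul0r -(rmorph0 (intr : int -> C)) => /intr_inj.
lia.
Qed.

Lemma pow3_neq0 n : (3 : C) ^+ n != 0.
Proof. by rewrite expf_neq0 // pnatr_eq0. Qed.

Lemma moser_form_parity e a b c d (n : nat) a' b' c' d' (n' : nat) :
  `|ring_point R a b c d n| = `|ring_point R a' b' c' d' n'| ->
  (2 %| moser_form e a b c d)%Z = (2 %| moser_form e a' b' c' d')%Z.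
Proof.
rewrite /ring_point -!exprnP !normf_div !normrX !normr_nat => h.
have {h} : (3 ^+ n' * `|lattice_point R a b c d|) ^+ 2 =
    (3 ^+ n * `|lattice_point R a' b' c' d'|) ^+ 2.
  congr (_ ^+ 2); move/eqP: h; rewrite eqr_div ?pow3_neq0 // => /eqP h.
  by rewrite mulrC h mulrC.
rewrite !exprMn => h.
have {h} : forall e,
    9 ^+ n' * moser_form e a b c d = 9 ^+ n * moser_form e a' b' c' d'.
  (* [D true] and [D false] are the coefficients of [1 + root33] and [1 - root33] in 6 times the
     difference of the two sides of [h]. *)
  pose D e := 9 ^+ n' * moser_form e a b c d
              - 9 ^+ n * moser_form e a' b' c' d'.
  have [] // := @root33_free (D true) (D false); rewrite /D.
    have := congr1 (fun z => 6 * z) h.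
    rewrite !(mulrCA 6 (_ ^+ _ ^+ 2)) !lattice_point_norm.
    rewrite !rmorphB !rmorphM !rmorphXn /=.
    rewrite -![_ ^+ _ ^+ 2]exprM ![(_ * 2)%N]mulnC !exprM => /eqP.
    rewrite (_ : 3 ^+ 2 = (9%:~R : C)); last by ring.
    by rewrite -subr_eq0 => /eqP <-; ring.
  by move=> xt xf; case; apply/eqP; rewrite -subr_eq0; apply/eqP.
move=> /(_ e) /(congr1 (fun m => (2 %| m)%Z)).
have odd9 m : coprimez 2 (9 ^+ m) by rewrite coprimezXr.
by rewrite !Gauss_dvdzr.
Qed.

(** Serves to bring two points to a common denominator. The multiplier is exhibited as a power of 3
    because such a factor preserves colors. *)
Lemma ring_point_pow3 a b c d k (n : nat) : (`|k| <= n)%N ->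
  exists j : nat, ring_point R a b c d k =
    ring_point R (3 ^+ j * a) (3 ^+ j * b) (3 ^+ j * c) (3 ^+ j * d) n.
Proof.
move=> kn; exists `|n%:Z - k|%N.
have kE : n%:Z = k + `|n%:Z - k|%N by lia.
rewrite /ring_point -lattice_pointZ rmorphXn /= {2}kE expfzDr ?pnatr_eq0 //.
rewrite -exprnP [(3%:~R)](_ : _ = 3) //.
have := pow3_neq0 `|n%:Z - k|; have : (3 : C) ^ k != 0.
  by rewrite expfz_neq0 // pnatr_eq0.
by move: (3 ^ k) (3 ^+ _) => x y x0 y0; field; apply/andP.
Qed.

(** * Colorings whose color classes are governed by the parity of one form *)

Section Coloring.
Variables (rule : int -> int -> int -> int -> nat) (e : bool).
Hypothesis rule_bound : forall a b c d, (1 <= rule a b c d <= 4)%N.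
Hypothesis ruleE : forall a b c d a' b' c' d',
  rule a b c d = rule a' b' c' d' <->
  (2 %| moser_form e (a - a') (b - b') (c - c') (d - d'))%Z.

(** The two vectors differ by [3 ^+ n - 1] times [(a, b, c, d)], and this factor is even. *)
Lemma rule_pow3 n a b c d :
  rule (3 ^+ n * a) (3 ^+ n * b) (3 ^+ n * c) (3 ^+ n * d) = rule a b c d.
Proof.
have E x : 3 ^+ n * x - x = (3 ^+ n - 1) * x by rewrite mulrBl mul1r.
apply/ruleE; rewrite !E moser_formZ dvdz_mulr //.
have : odd `|3 ^+ n|%N by rewrite abszX oddX orbT.
lia.
Qed.

(** Links colors to lengths: the form that decides equality of colors is evaluated on a
    representation of the difference, where [moser_form_parity] applies. *)
Lemma rule_eq_ring_point a b c d k a' b' c' d' k' :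
  exists x y z t, exists2 n : nat,
    ring_point R a b c d k - ring_point R a' b' c' d' k'
    = ring_point R x y z t n
  & rule a b c d = rule a' b' c' d' <-> (2 %| moser_form e x y z t)%Z.
Proof.
have [j ->] := ring_point_pow3 a b c d (leq_addr `|k'| `|k|).
have [j' ->] := ring_point_pow3 a' b' c' d' (leq_addl `|k| `|k'|).
do 4 eexists; exists (`|k| + `|k'|)%N.
  by rewrite /ring_point -mulrBl lattice_pointB.
by rewrite -ruleE !rule_pow3.
Qed.

Lemma rule_well_defined a b c d k a' b' c' d' k' :
  ring_point R a b c d k = ring_point R a' b' c' d' k' ->
  rule a b c d = rule a' b' c' d'.
Proof.
have [x [y [z [t [n E ->]]]]] := rule_eq_ring_point a b c d k a' b' c' d' k'.
move=> h.
rewrite (@moser_form_parity e x y z t n 0 0 0 0 0); first by case: (e).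
by rewrite -E h subrr /ring_point /lattice_point !mul0r !addr0 mul0r.
Qed.

Lemma ring_coloring_exists :
  exists (gamma : carrier (@moser_lattice R) -> nat)
         (pi : carrier (@moser_ring R) -> nat),
     [/\ lattice_color_map rule gamma,
         geometric_coloring 4 gamma,
         ring_color_map rule pi,
         geometric_coloring 4 pi
       & extends gamma pi].
Proof.
(* The value chosen at [v] must fit all representations of [v] at once; one representation supplies
   it and [rule_well_defined] covers the others. *)
have [|pi piP] := @choice (carrier (@moser_ring R)) nat (fun v m =>
    forall a b c d k, val v = ring_point R a b c d k -> m = rule a b c d).
  move=> v; have /asboolP[a [b [c [d [k vE]]]]] := valP v.
  exists (rule a b c d) => a' b' c' d' k'; rewrite vE.
  exact: rule_well_defined.
have diffP x y : exists a b c d, exists2 n : nat,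
    val x - val y = ring_point R a b c d n
    & pi x = pi y <-> (2 %| moser_form e a b c d)%Z.
  have /asboolP[a [b [c [d [k xE]]]]] := valP x.
  have /asboolP[a' [b' [c' [d' [k' yE]]]]] := valP y.
  by rewrite (piP _ _ _ _ _ _ xE) (piP _ _ _ _ _ _ yE) xE yE;
    apply: rule_eq_ring_point.
have piG : geometric_coloring 4 pi.
  split=> [x|x y|x y z w].
  - have /asboolP[a [b [c [d [k xE]]]]] := valP x.
    by rewrite (piP _ _ _ _ _ _ xE).
  - have [a [b [c [d [n E ->]]]]] := diffP x y.
    rewrite /dist E => N.
    rewrite (@moser_form_parity e a b c d n 1 0 0 0 0); first by case: (e).
    by rewrite N /ring_point /lattice_point !mul0r !addr0 divr1 normr1.
  - have [a [b [c [d [n E ->]]]]] := diffP x y.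
    have [a' [b' [c' [d' [n' E' ->]]]]] := diffP z w.
    by rewrite /dist E E' => /(moser_form_parity e) ->.
have latticeE a b c d : lattice_point R a b c d = ring_point R a b c d 0.
  by rewrite /ring_point divr1.
have sub : {subset @moser_lattice R <= @moser_ring R}.
  move=> z /asboolP[a [b [c [d ->]]]]; apply/asboolP.
  by exists a, b, c, d, 0.
pose emb (x : carrier (@moser_lattice R)) : carrier (@moser_ring R) :=
  exist _ (val x) (sub _ (valP x)).
have [bd un ge] := piG.
(* The lattice coloring is the restriction of [pi], so it inherits every property. *)
exists (pi \o emb), pi; split=> //.
- by move=> v a b c d vE; apply: (piP (emb v) a b c d 0); rewrite -latticeE.
- split=> [x|x y|x y z w] /=; first exact: bd.
    exact: (un (emb x) (emb y)).
  exact: (ge (emb x) (emb y) (emb z) (emb w)).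
- by split=> // x y xy; congr pi; apply: val_inj.
Qed.

End Coloring.
End Norm.

(** * The two color rules modulo 2 *)

Lemma dvd2_form (x y : int) :
  (2 %| x)%Z && (2 %| y)%Z = (2 %| x ^+ 2 + x * y + y ^+ 2)%Z.
Proof.
have F2 := pchar_Fp (isT : prime 2).
rewrite !(dvdz_pcharf F2) !(rmorphD, rmorphM, rmorphXn) /=.
(* Checking the four pairs of residues shows that the form has no nontrivial zero over the field
   with two elements. *)
by move: (x%:~R) (y%:~R) => [[|[|//]] ?] [[|[|//]] ?].
Qed.

Lemma color_bound x y : (1 <= 1 + residue2 x + 2 * residue2 y <= 4)%N.
Proof. rewrite /residue2; lia. Qed.

Lemma color_eq x y x' y' :
  (1 + residue2 x + 2 * residue2 y = 1 + residue2 x' + 2 * residue2 y')%N <->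
  (2 %| (x - x') ^+ 2 + (x - x') * (y - y') + (y - y') ^+ 2)%Z.
Proof. by rewrite -dvd2_form /residue2; lia. Qed.

Lemma color_rule1E a b c d a' b' c' d' :
  color_rule1 a b c d = color_rule1 a' b' c' d' <->
  (2 %| moser_form true (a - a') (b - b') (c - c') (d - d'))%Z.
Proof.
rewrite color_eq.
have -> : a + b + d - (a' + b' + d') = (a - a') + (b - b') + (d - d') by ring.
have -> : a + c + d - (a' + c' + d') = (a - a') + (c - c') + (d - d') by ring.
move: (a - a') (b - b') (c - c') (d - d') => {}a {}b {}c {}d.
(* The factor after 2 is half the difference between [moser_form true] and the form of [dvd2_form]
   at the two linear forms of the rule; all coefficients of that difference are even. *)
have -> : moser_form true a b c d =
    ((a + b + d) ^+ 2 + (a + b + d) * (a + c + d) + (a + c + d) ^+ 2)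
    + 2 * (b ^+ 2 + c ^+ 2 + a * c + b * d - 2 * a * d + b * c).
  by rewrite /moser_form; ring.
by rewrite [(2 %| _ + 2 * _)%Z]rpredDr ?dvdz_mulr.
Qed.

Lemma color_rule2E a b c d a' b' c' d' :
  color_rule2 a b c d = color_rule2 a' b' c' d' <->
  (2 %| moser_form false (a - a') (b - b') (c - c') (d - d'))%Z.
Proof.
rewrite color_eq.
have -> : a + d - (a' + d') = (a - a') + (d - d') by ring.
have -> : b + c + d - (b' + c' + d') = (b - b') + (c - c') + (d - d') by ring.
move: (a - a') (b - b') (c - c') (d - d') => {}a {}b {}c {}d.
have -> : moser_form false a b c d =
    ((a + d) ^+ 2 + (a + d) * (b + c + d) + (b + c + d) ^+ 2)
    + 2 * (a ^+ 2 + b ^+ 2 + c ^+ 2 + a * b + 2 * a * c + b * d).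
  by rewrite /moser_form; ring.
by rewrite [(2 %| _ + 2 * _)%Z]rpredDr ?dvdz_mulr.
Qed.

Theorem mainTheorem3 (R : realType) :
  (exists (gamma1 : carrier (@moser_lattice R) -> nat)
          (pi : carrier (@moser_ring R) -> nat),
     [/\ lattice_color_map color_rule1 gamma1,
         geometric_coloring 4 gamma1,
         ring_color_map color_rule1 pi,
         geometric_coloring 4 pi
       & extends gamma1 pi]) /\
  (exists (gamma2 : carrier (@moser_lattice R) -> nat)
          (pi : carrier (@moser_ring R) -> nat),
     [/\ lattice_color_map color_rule2 gamma2,
         geometric_coloring 4 gamma2,
         ring_color_map color_rule2 pi,
         geometric_coloring 4 pi
       & extends gamma2 pi]).
Proof.
split.
  apply: (@ring_coloring_exists R color_rule1 true) => *.
    exact: color_bound.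
  exact: color_rule1E.
apply: (@ring_coloring_exists R color_rule2 false) => *.
  exact: color_bound.
exact: color_rule2E.
Qed.
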